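(* For every positive integer $n$, $$\operatorname{disc}(n)\leq 2^{1-1/\lceil n/2\rceil},$$ where, as $n\to\infty$, $$2^{1-1/\lceil n/2\rceil}=2-\frac{4\ln 2}{n}+O\left(\frac1{n^2}\right).$$
   Context: For a partition $\mathcal I$ of $[0,1]$ into finitely many intervals (each of positive length, overlapping at most at endpoints), let $|I|$ denote the length of an interval $I$ and define $$\operatorname{disc}(\mathcal I)=\max_{I_1,I_2\in\mathcal I}\frac{|I_1|}{|I_2|}.$$ A strategy of length $n$ is a sequence $\mathcal S=(\mathcal I_1,\mathcal I_2,\dots,\mathcal I_n)$ such that $\mathcal I_i$ is a partition of $[0,1]$ into $i$ intervals for each $i$, and $\mathcal I_{i+1}$ is formed from $\mathcal I_i$ by dividing a single interval into two (for $1\le i\le n-1$). Define $$\operatorname{disc}(\mathcal S)=\max_{1\le t\le n}\operatorname{disc}(\mathcal I_t),\qquad \operatorname{disc}(n)=\min_{\mathcal S}\operatorname{disc}(\mathcal S),$$ where the minimum is over all strategies $\mathcal S$ of length $n$. *)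

(* Defs.v *)
From mathcomp Require Import all_boot all_order all_algebra finmap.
From mathcomp Require Import all_classical all_reals all_analysis.

Set Implicit Arguments.
Unset Strict Implicit.
Unset Printing Implicit Defensive.

Import Order.TTheory GRing.Theory Num.Theory.
Import numFieldNormedType.Exports.

Local Open Scope classical_set_scope.
Local Open Scope ring_scope.

Section Discrepancy.
Context {R : realType}.

(* The pair I stands for the closed interval [I.1, I.2]. *)
Definition itv_set (I : R * R) : set R := `[I.1, I.2]%classic.

Definition itv_len (I : R * R) : R := I.2 - I.1.

Definition is_partition (P : {fset R * R}) : Prop :=
  [/\ forall I : R * R, I \in P -> I.1 < I.2,
      \bigcup_(I in [set` P]) itv_set I = `[0, 1]%classic &
      forall I J : R * R, I \in P -> J \in P -> I != J ->
        itv_set I `&` itv_set J `<=` [set I.1; I.2] `&` [set J.1; J.2]].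

(* The default value 0 of the maxima is irrelevant for a partition: it has at
   least one interval, and the ratios are all positive. *)
Definition disc_partition (P : {fset R * R}) : R :=
  \big[Num.max/0]_(I <- P) \big[Num.max/0]_(J <- P) (itv_len I / itv_len J).

Definition divides_one (P Q : {fset R * R}) : Prop :=
  exists (I : R * R) (c : R), [/\ I \in P, I.1 < c < I.2 &
    Q = ((P `\ I) `|` [fset (I.1, c); (c, I.2)])%fset].

(* A strategy of length n is (S 1, ..., S n); the values of S at other indices
   play no role. *)
Definition is_strategy (n : nat) (S : nat -> {fset R * R}) : Prop :=
  (forall t, (1 <= t <= n)%N -> is_partition (S t) /\ #|` S t| = t) /\
  (forall t, (1 <= t < n)%N -> divides_one (S t) (S t.+1)).

Definition disc_strategy (n : nat) (S : nat -> {fset R * R}) : R :=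
  \big[Num.max/0]_(1 <= t < n.+1) disc_partition (S t).

End Discrepancy.

(* For n > 0 this set of values is nonempty and bounded below, and its infimum
   is attained (by compactness: a bound on the discrepancy bounds all interval
   lengths away from 0), so the infimum is the minimum over all strategies. *)
Definition disc (R : realType) (n : nat) : R :=
  inf [set disc_strategy n S | S in [set S | is_strategy n S]].

(* Main.v *)
(* Put m = ceil(n/2) and q = 2^(1/m). Strategies are built from their lists of
   lengths: any list obtained by splitting a length in two can be realized by
   dividing an interval. At time m the lengths are proportional to 1, q, ...,
   q^(m-1), with discrepancy q^(m-1) = 2^(1-1/m). After time m the largest
   interval is repeatedly halved, so that the lengths stay in a window
   {x q^e, ..., x q^(e+m-1)}. Before time m, going backwards, the two smallest
   lengths are merged. This preserves the property that consecutive lengths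
   a_1 < ... < a_k < 2 a_1 have ratios at least q, because 2 a_1 <= a_1 + a_2
   and a_1 + a_2 <= 2 a_2. The ratio 2 a_1 / a_k >= q bounds the discrepancy
   by 2/q. *)

Require Import Defs.
From mathcomp Require Import all_boot all_order all_algebra finmap.
From mathcomp Require Import all_classical all_reals all_analysis.
From mathcomp Require Import zify lra ring.
Import Order.TTheory GRing.Theory Num.Theory.
Import numFieldNormedType.Exports.
Local Open Scope classical_set_scope.
Local Open Scope ring_scope.

(** * Lists of lengths: splitting and merging *)

Definition splits {R : realType} (s t : seq R) : Prop :=
  exists (a b : R) (r : seq R),
    [/\ 0 < a, 0 < b, perm_eq s (a + b :: r) & perm_eq t [:: a, b & r]].

(** The lists are kept in increasing order: the smallest two entries stand in front, and under
    [log_spread] their sum is the new largest. *)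
Definition merge_first_two {R : realType} (s : seq R) : seq R :=
  if s is [:: a, b & r] then rcons r (a + b) else s.

(** Here [a] precedes [b]. The second inequality is the first for the pair [b], [2 * a]: the list
    continued by its doubles still has ratios at least [q]. *)
Definition spread_rel {R : realType} (q : R) : rel R :=
  fun a b => (q * a <= b) && (q * b <= 2 * a).

Definition log_spread {R : realType} (q : R) (s : seq R) : bool :=
  all (fun a => 0 < a) s && pairwise (spread_rel q) s.

Lemma size_merge_first_two (R : realType) (s : seq R) :
  (1 < size s)%N -> size (merge_first_two s) = (size s).-1.
Proof. by case: s => [|a [|b r]] //= _; rewrite size_rcons. Qed.

Lemma sum_merge_first_two (R : realType) (s : seq R) :
  \sum_(a <- merge_first_two s) a = \sum_(a <- s) a.
Proof.
case: s => [|a [|b r]] //=.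
by rewrite -cats1 big_cat big_seq1 !big_cons /= addrC addrA.
Qed.

Lemma splits_merge_first_two (R : realType) (s : seq R) :
  all (fun a => 0 < a) s -> (1 < size s)%N -> splits (merge_first_two s) s.
Proof.
case: s => [|a [|b r]] //= /and3P[a0 b0 _] _; exists a, b, r; split=> //.
by rewrite perm_rcons.
Qed.

(** For each remaining [c], [q * c <= 2 * a <= a + b], while [q * a <= c] and [q * b <= c] add up to
    [q * (a + b) <= 2 * c]. *)
Lemma log_spread_merge (R : realType) (q : R) (s : seq R) :
  1 <= q -> log_spread q s -> log_spread q (merge_first_two s).
Proof.
case: s => [|a [|b r]] // q1 /andP[/= /and3P[a0 b0 r0]].
move=> /and3P[/andP[/andP[ab1 ab2] ar] br pr].
apply/andP; split; first by rewrite all_rcons addr_gt0.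
rewrite pairwise_rcons pr andbT; apply/allP => c cr.
have /andP[ac1 ac2] := allP ar _ cr; have /andP[bc1 bc2] := allP br _ cr.
rewrite /spread_rel mulrDr.
have ab : a <= b by apply: le_trans ab1; rewrite ler_peMl // ltW.
have qbc : q * c <= a + b by apply: (le_trans ac2); lra.
by rewrite qbc /=; lra.
Qed.

Lemma log_spread_ratio (R : realType) (q : R) (s : seq R) (u v : R) :
  1 <= q <= 2 -> log_spread q s -> u \in s -> v \in s -> q * u <= 2 * v.
Proof.
move=> /andP[q1 q2] /andP[/allP s0 ps] us vs.
elim: s s0 ps us vs => // a s IH s0 /= /andP[/allP as_ ps].
have {}IH : u \in s -> v \in s -> q * u <= 2 * v.
  by apply: IH => // x xs; apply: s0; rewrite inE xs orbT.
have a0 : 0 < a by apply: s0; rewrite mem_head.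
rewrite !inE => /orP[/eqP->|us] /orP[/eqP->|vs]; last exact: IH.
- by rewrite ler_pM2r.
- have /andP[h _] := as_ _ vs; apply: (le_trans h).
  by have := s0 v; rewrite inE vs orbT => /(_ isT); lra.
- by have /andP[] := as_ _ us.
Qed.

(** * Lengths at times 1 to 2m *)

Section Lengths.
Context {R : realType} (q : R) (m : nat).
Context (q1 : 1 <= q) (qm : q ^+ m = 2) (m0 : (0 < m)%N).

Let total := \sum_(i <- iota 0 m) q ^+ i.
Let geom i := total^-1 * q ^+ i.
Let middle : seq R := [seq geom i | i <- iota 0 m].

(* The lengths at times m - k and m + j. *)
Let before k := iter k merge_first_two middle.
Let after j := [seq geom i | i <- iota 0 (m - j)] ++
  [seq geom i / 2 | i <- iota (m - j) j] ++
  [seq geom i / 2 | i <- iota (m - j) j].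

Let q_gt0 : 0 < q. Proof. exact: lt_le_trans q1. Qed.

Let q_le2 : q <= 2.
Proof. by rewrite -qm -[leLHS]expr1; apply: ler_weXn2l. Qed.

Let total_gt0 : 0 < total.
Proof.
rewrite /total -(prednK m0) /= big_cons expr0 ltr_pwDl //.
by apply: sumr_ge0 => i _; rewrite exprn_ge0 // ltW.
Qed.

Let geom_gt0 i : 0 < geom i.
Proof. by rewrite mulr_gt0 ?invr_gt0 ?exprn_gt0. Qed.

Let geom_le i j : (i <= j)%N -> geom i <= geom j.
Proof. by move=> ij; rewrite ler_pM2l ?invr_gt0 // ler_weXn2l. Qed.

Let geomS i : q * geom i = geom i.+1.
Proof. by rewrite /geom mulrCA -exprS. Qed.

(** Halving lowers the exponent by [m], so halves of the largest lengths rejoin the progression at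
    its lower end. *)
Let geomDm i : geom (m + i) = 2 * geom i.
Proof. by rewrite /geom exprD qm mulrCA. Qed.

Let middle_spread : log_spread q middle.
Proof.
apply/andP; split; first by apply/allP => _ /mapP[i _ ->].
rewrite pairwise_map; apply/(pairwiseP 0%N) => i j.
rewrite !inE size_iota => im jm ij; rewrite /relpre /spread_rel /= !nth_iota //.
(* Only exponents are compared: [i + 1 <= j] and [j + 1 <= m + i]. *)
by rewrite !add0n !geomS -geomDm !geom_le //; lia.
Qed.

Let before_spread k : log_spread q (before k).
Proof. by elim: k => //= k IH; apply: log_spread_merge. Qed.

Let size_before k : (k < m)%N -> size (before k) = (m - k)%N.
Proof.
elim: k => [_|k IH km] /=; first by rewrite size_map size_iota subn0.
by rewrite size_merge_first_two IH; lia.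
Qed.

Let before_last : before m.-1 = [:: 1].
Proof.
have : \sum_(a <- before m.-1) a = 1.
  have -> : \sum_(a <- before m.-1) a = \sum_(a <- middle) a.
    by elim: m.-1 => //= k IH; rewrite sum_merge_first_two.
  by rewrite big_map -mulr_sumr mulVf // gt_eqF.
have : size (before m.-1) = 1%N by rewrite size_before; lia.
by case: (before m.-1) => [|a [|b r]] //= _; rewrite big_seq1 => ->.
Qed.

Let after_splits j : (j < m)%N -> splits (after j) (after j.+1).
Proof.
move=> jm; have mj : (m - j = (m - j.+1).+1)%N by lia.
(* The largest length not yet halved has exponent [m - j - 1]; each block of halves receives one of
   its halves. *)
exists (geom (m - j.+1) / 2), (geom (m - j.+1) / 2),
  ([seq geom i | i <- iota 0 (m - j.+1)] ++
   [seq geom i / 2 | i <- iota (m - j) j] ++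
   [seq geom i / 2 | i <- iota (m - j) j]).
split; rewrite ?divr_gt0 //.
  rewrite -splitr /after {1}mj -addn1 iotaD map_cat /= add0n.
  by apply/permP => p; rewrite /= !count_cat /=; lia.
rewrite /after /= -mj.
by apply/permP => p; rewrite /= !count_cat /= !count_cat /=; lia.
Qed.

Let after_ratio j u v : (j <= m)%N -> u \in after j -> v \in after j ->
  0 < v /\ q * u <= 2 * v.
Proof.
move=> jm.
(* All lengths lie between [geom (m - j) / 2] and [geom (m - j) / q], whose ratio is [2 / q]. *)
have bounds w : w \in after j ->
    geom (m - j) <= 2 * w /\ q * w <= geom (m - j).
  rewrite !mem_cat orbb => /orP[] /mapP[i]; rewrite mem_iota => ij ->.
    by rewrite -geomDm geomS !geom_le //; lia.
  rewrite [2 * _]mulrC divfK ?pnatr_eq0 // geom_le; last by lia.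
  split=> //; rewrite mulrA geomS ler_pdivrMr // mulrC -geomDm geom_le //; lia.
move=> /bounds[_ hu] /bounds[hv _]; split; last exact: le_trans hv.
by have := geom_gt0 (m - j); lra.
Qed.

Lemma exists_lengths : exists M : nat -> seq R,
  [/\ M 1%N = [:: 1],
      forall t, (1 <= t < m.*2)%N -> splits (M t) (M t.+1) &
      forall t, (1 <= t <= m.*2)%N -> forall u v, u \in M t -> v \in M t ->
        0 < v /\ q * u <= 2 * v].
Proof.
exists (fun t => if (t <= m)%N then before (m - t) else after (t - m)).
split=> [|t /andP[t1 t2]|t /andP[t1 t2] u v].
- by rewrite m0 subn1.
- have [tm|mt|->] := ltngtP t m.
  + rewrite (_ : m - t = (m - t.+1).+1)%N; last by lia.
    apply: splits_merge_first_two;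
      first by case/andP: (before_spread (m - t.+1)).
    by rewrite size_before; lia.
  + by rewrite subSn; [apply: after_splits; lia|lia].
  + rewrite subnn subSn // subnn.
    (* The two descriptions agree at time [m], where both give [middle]. *)
    have -> : before 0 = after 0 by rewrite /after /= cats0 subn0.
    exact: after_splits.
- case: leqP => tm; last by apply: after_ratio; lia.
  move=> hu hv; have sp := before_spread (m - t).
  split; last by apply: log_spread_ratio hu hv => //; rewrite q1.
  by case/andP: sp => /allP /(_ _ hv).
Qed.

End Lengths.

(** * Bounding the discrepancy *)

Lemma bigmax_le_seq (R : realType) (I : eqType) (s : seq I) (P : pred I)
    (F : I -> R) (K : R) :
  0 <= K -> (forall i, i \in s -> P i -> F i <= K) ->
  \big[Num.max/0]_(i <- s | P i) F i <= K.
Proof.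
move=> K0 FK; rewrite big_seq_cond.
by apply: bigmax_le => // i /andP[]; exact: FK.
Qed.

Lemma disc_partition_le (R : realType) (P : {fset R * R}) (K : R) :
  0 <= K ->
  (forall I J, I \in P -> J \in P ->
     0 < itv_len J /\ itv_len I <= K * itv_len J) ->
  disc_partition P <= K.
Proof.
move=> K0 PK; apply: bigmax_le_seq => // I IP _.
apply: bigmax_le_seq => // J JP _; have [J0 IJ] := PK _ _ IP JP.
by rewrite ler_pdivrMr.
Qed.

Lemma disc_le (R : realType) (n : nat) (S : nat -> {fset R * R}) :
  is_strategy n S -> disc R n <= disc_strategy n S.
Proof.
move=> nS; apply: ge_inf; last by exists S.
(* The maxima start from 0, which gives the lower bound that [inf] requires. *)
by exists 0 => _ [S' _ <-]; apply: bigmax_ge_id.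
Qed.

(** * Realizing lists of lengths by partitions *)

Lemma partition_inside {R : realType} {P : {fset R * R}} {I J : R * R} {x : R} :
  is_partition P -> I \in P -> J \in P -> I.1 < x < I.2 -> J.1 <= x <= J.2 ->
  J = I.
Proof.
move=> [_ _ disj] IP JP /andP[x1 x2] xJ; apply/eqP/negPn/negP => JI.
have [] : ([set J.1; J.2] `&` [set I.1; I.2]) x.
  by apply: (disj _ _ JP IP JI); split; rewrite /itv_set /= in_itv //= !ltW.
by move=> _ [/= xI|/= xI]; rewrite xI ltxx in x1 x2.
Qed.

(** The [perm_eq] records that the two pieces are distinct and new, so that no length is lost when
    [Q] is formed as a set. *)
Lemma is_partition_split {R : realType} {P : {fset R * R}} {I : R * R} {c : R} :
  is_partition P -> I \in P -> I.1 < c < I.2 ->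
  let Q := ((P `\ I) `|` [fset (I.1, c); (c, I.2)])%fset in
  is_partition Q /\ perm_eq Q [:: (I.1, c), (c, I.2) & (P `\ I)%fset].
Proof.
move=> partP IP cI Q; have /andP[Ic cI2] := cI.
have [pos cover disj] := partP.
(* Both pieces contain [c] and no other interval of [P] does, hence the pieces are new. *)
have cNP J : J \in (P `\ I)%fset -> ~~ (J.1 <= c <= J.2).
  rewrite !inE => /andP[JI JP]; apply: contraNN JI => cJ.
  by rewrite (partition_inside partP IP JP cI cJ).
have memQ J : (J \in Q) =
    [|| J == (I.1, c), J == (c, I.2) | J \in (P `\ I)%fset].
  by rewrite /Q !in_fsetE orbC -orbA.
have sub1 : itv_set (I.1, c) `<=` itv_set I.
  by move=> x; rewrite /itv_set /= !in_itv /=; lra.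
have sub2 : itv_set (c, I.2) `<=` itv_set I.
  by move=> x; rewrite /itv_set /= !in_itv /=; lra.
have end1 J : J \in (P `\ I)%fset -> itv_set (I.1, c) `&` itv_set J `<=`
    [set I.1; c] `&` [set J.1; J.2].
  rewrite !inE => /andP[JI JP] x [xA xJ].
  (* A point shared with [J] is an endpoint of [I], and of these only [I.1] lies in the left
     piece. *)
  have [] := disj _ _ JP IP JI x (conj xJ (sub1 _ xA)).
  move=> xJe [/= xI|/= xI]; split=> //; first by left.
  by move: xA; rewrite /itv_set /= in_itv /= xI; lra.
have end2 J : J \in (P `\ I)%fset -> itv_set (c, I.2) `&` itv_set J `<=`
    [set c; I.2] `&` [set J.1; J.2].
  rewrite !inE => /andP[JI JP] x [xA xJ].
  have [] := disj _ _ JP IP JI x (conj xJ (sub2 _ xA)).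
  move=> xJe [/= xI|/= xI]; split=> //; last by right.
  by move: xA; rewrite /itv_set /= in_itv /= xI; lra.
have end12 : itv_set (I.1, c) `&` itv_set (c, I.2) `<=`
    [set I.1; c] `&` [set c; I.2].
  move=> x []; rewrite /itv_set /= !in_itv /= => x1 x2.
  by have -> : x = c; [lra|split; [right|left]].
split; last first.
  apply: uniq_perm; first exact: fset_uniq.
    rewrite /= fset_uniq inE negb_or xpair_eqE (lt_eqF Ic) /= andbT.
    by apply/andP; split; apply/negP => /cNP /=; rewrite lexx ltW.
  by move=> J; rewrite [LHS]memQ !inE.
split.
- move=> J; rewrite memQ => /or3P[/eqP->|/eqP->|] //.
  by rewrite !inE => /andP[_ /pos].
- rewrite -cover; apply/seteqP; split=> x [J /= JQ xJ].
    move: JQ; rewrite memQ => /or3P[/eqP JE|/eqP JE|].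
    + by exists I => //; apply: sub1; rewrite -JE.
    + by exists I => //; apply: sub2; rewrite -JE.
    + by rewrite !inE => /andP[_ JP]; exists J.
  have [JI|JI] := eqVneq J I; last first.
    by exists J => //=; rewrite memQ !inE JI JQ !orbT.
  have [xc|cx] := leP x c.
    exists (I.1, c); first by rewrite /= memQ eqxx.
    by move: xJ; rewrite JI /itv_set /= !in_itv /=; lra.
  exists (c, I.2); first by rewrite /= memQ eqxx orbT.
  by move: xJ; rewrite JI /itv_set /= !in_itv /=; lra.
- move=> J K; rewrite !memQ.
  move=> /or3P[/eqP->|/eqP->|JP]
    /or3P[/eqP->|/eqP->|KP]; rewrite ?eqxx // => JK.
  + exact: end1.
  + by rewrite setIC [X in _ `<=` X]setIC.
  + exact: end2.
  + by rewrite setIC [X in _ `<=` X]setIC; apply: end1.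
  + by rewrite setIC [X in _ `<=` X]setIC; apply: end2.
  + by move: JP KP; rewrite !inE => /andP[_ JP] /andP[_ KP]; apply: disj.
Qed.

(** A sequence, since equal lengths have to be counted with multiplicity. *)
Definition lengths {R : realType} (P : {fset R * R}) : seq R :=
  [seq itv_len J | J <- P].

(** Some interval has length [a + b]; it is cut at distance [a] from its left end. *)
Lemma realize_splits {R : realType} {P : {fset R * R}} {s t : seq R} :
  is_partition P -> perm_eq (lengths P) s -> splits s t ->
  exists Q, [/\ is_partition Q, divides_one P Q & perm_eq (lengths Q) t].
Proof.
move=> partP Ps [a [b [r [a0 b0 sab tab]]]].
have Pab : perm_eq (lengths P) (a + b :: r) by apply: perm_trans sab.
have /mapP[I IP abI] : a + b \in lengths P by rewrite (perm_mem Pab) mem_head.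
have cI : I.1 < I.1 + a < I.2 by move: abI; rewrite /itv_len; lra.
have [partQ permQ] := is_partition_split partP IP cI.
eexists; split; [exact: partQ|by exists I, (I.1 + a)|].
have {}permQ := perm_map itv_len permQ.
rewrite (perm_trans permQ) // (permPr tab) /= {1 2}/itv_len /=.
rewrite addrAC subrr add0r (_ : I.2 - _ = b); last first.
  by move: abI; rewrite /itv_len; lra.
(* Cancelling [a] and [b] and restoring [a + b] leaves the claim that [P] consists of [I] and the
   other intervals. *)
rewrite !perm_cons -(perm_cons (a + b)) -(permPr Pab) abI perm_sym.
rewrite -map_cons /lengths; apply: perm_map; apply: uniq_perm => /=.
- exact: fset_uniq.
- by rewrite fset_uniq !inE eqxx.
- by move=> J; rewrite !inE; case: eqP => // ->.
Qed.

Lemma size_lengths {R : realType} (P : {fset R * R}) :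
  size (lengths P) = #|` P|.
Proof. by rewrite size_map. Qed.

Lemma is_partition01 {R : realType} : is_partition [fset ((0, 1) : R * R)]%fset.
Proof.
split.
- by move=> I; rewrite inE => /eqP ->.
- rewrite set_fset1 bigcup_set1 //.
- by move=> I J; rewrite !inE => /eqP -> /eqP ->; rewrite eqxx.
Qed.

Lemma exists_strategy {R : realType} (M : nat -> seq R) (n : nat) :
  M 1%N = [:: 1] -> (forall t, (1 <= t < n)%N -> splits (M t) (M t.+1)) ->
  exists S, is_strategy n S /\
    forall t, (1 <= t <= n)%N -> perm_eq (lengths (S t)) (M t).
Proof.
move=> M1 Msplit.
have sizeM t : (1 <= t <= n)%N -> size (M t) = t.
  elim: t => // -[|t] IH tn; first by rewrite M1.
  have [a [b [r [_ _ /perm_size e1 /perm_size e2]]]] := Msplit t.+1 tn.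
  by move: e1; rewrite e2 IH /= => [<-//|]; lia.
(* The cardinality follows from [sizeM], so the induction on [n] can omit it. *)
suff [S [S1 S2]] : exists S : nat -> {fset R * R},
    (forall t, (1 <= t <= n)%N ->
       is_partition (S t) /\ perm_eq (lengths (S t)) (M t)) /\
    (forall t, (1 <= t < n)%N -> divides_one (S t) (S t.+1)).
  exists S; split=> [|t /S1[]//]; split=> // t tn; have [pS lS] := S1 _ tn.
  by rewrite -size_lengths (perm_size lS) sizeM.
elim: n Msplit {sizeM} => [_|[|n] IH Msplit].
- by exists (fun=> fset0); split=> t; lia.
- exists (fun=> [fset (0, 1)]%fset); split=> t tn; last by lia.
  have -> : t = 1%N by lia.
  split; first exact: is_partition01.
  rewrite M1 (_ : [:: 1] = [seq itv_len J | J <- [:: (0, 1)]]); last first.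
    by rewrite /= /itv_len subr0.
  apply: perm_map; apply: uniq_perm => // [|J]; first exact: fset_uniq.
  by rewrite !inE.
have [|S [S1 S2]] := IH; first by move=> t tn; apply: Msplit; lia.
have [|pS lS] := S1 n.+1; first by lia.
have [|Q [pQ dQ lQ]] := realize_splits pS lS (Msplit n.+1 _); first by lia.
exists (fun t => if (t <= n.+1)%N then S t else Q); split=> t tn.
  case: leqP => tn'; first by apply: S1; lia.
  by have -> : t = n.+2 by lia.
have [->|tn'] := eqVneq t n.+1; first by rewrite leqnn ltnn.
have tn1 : (t < n.+1)%N by lia.
by rewrite tn1 (ltnW tn1); apply: S2; lia.
Qed.

(** * The asymptotic expansion *)

Lemma ceil_half (R : realType) (n : nat) :
  (Num.ceil (n%:R / 2 : R))%:~R = (uphalf n)%:R :> R.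
Proof.
rewrite (_ : Num.ceil _ = (uphalf n)%:Z) //; apply: ceil_def.
rewrite intrB mulr1z -[_%:~R]/((uphalf n)%:R : R).
have : ((uphalf n).*2 = odd n + n)%N := uphalfK n.
move=> /(congr1 (fun k => k%:R : R)); rewrite -mul2n natrM natrD.
by case: (odd n) => /= h; apply/andP; split; lra.
Qed.

(** The upper bound comes from [expR u >= 1 + u] and [(1 + u) * (1 - u + u ^+ 2) = 1 + u ^+ 3 >=
    1]. *)
Lemma expRN_bounds (R : realType) (u : R) :
  0 <= u -> 1 - u <= expR (- u) <= 1 - u + u ^+ 2.
Proof.
move=> u0; apply/andP; split; first exact: expR_ge1Dx.
rewrite expRN -div1r ler_pdivrMr ?expR_gt0 //.
have : 0 <= 1 - u + u ^+ 2 by nra.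
move=> /ler_wpM2l /(_ _ _ (expR_ge1Dx u)); apply: le_trans.
by nra.
Qed.

Lemma ln2_le1 (R : realType) : ln 2 <= 1 :> R.
Proof.
rewrite -[leRHS]expRK ler_ln ?posrE ?expR_gt0 //.
exact: expR_ge1Dx.
Qed.

Lemma pow2_asymptotics (R : realType) (n : nat) : (0 < n)%N ->
  `|2 `^ (1 - 1 / (uphalf n)%:R) - (2 - 4 * ln 2 / n%:R)| <=
  12 * (1 / n%:R ^+ 2) :> R.
Proof.
move=> n0; set m := uphalf n.
have m0 : (0 < m)%N by rewrite uphalf_gt0.
have x0 : 0 < n%:R :> R by rewrite ltr0n.
have y0 : 0 < m%:R :> R by rewrite ltr0n.
have nm : n%:R <= 2 * m%:R :> R by rewrite -natrM ler_nat /m; lia.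
have mn : 2 * m%:R <= n%:R + 1 :> R.
  by rewrite -natrM natr1 ler_nat /m; lia.
set x : R := n%:R in x0 nm mn *; set y : R := m%:R in y0 nm mn *.
have l1 : ln 2 <= 1 :> R := ln2_le1 R.
have l0 : 0 <= ln 2 :> R by rewrite ln_ge0 // ler1n.
set l : R := ln 2 in l0 l1 *.
have -> : 2 `^ (1 - 1 / y) = 2 * expR (- (l / y)) :> R.
  rewrite /powR pnatr_eq0 /= mulrBl div1r expRD mul1r lnK ?posrE //.
  by rewrite -/l [_^-1 * _]mulrC.
(* With [u = l / y], the error is [4 * l / x - 2 * u] plus a term in [[0, 2 * u ^+ 2]]. These
   contribute at most 4 and 8 times [1 / x ^+ 2], whence the constant 12. *)
have u0 : 0 <= l / y by rewrite divr_ge0 // ltW.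
have /andP[e1 e2] := expRN_bounds _ _ u0.
have u2 : (l / y) ^+ 2 <= 4 * (1 / x ^+ 2).
  have : l / y <= 2 / x.
    rewrite ler_pdivrMr // mulrAC ler_pdivlMr //; nra.
  have -> : 4 * (1 / x ^+ 2) = (2 / x) ^+ 2 by rewrite expr_div_n; field; lra.
  by move=> h; rewrite ler_sqr ?nnegrE // (le_trans u0 h).
(* Rounding [n / 2] up costs little: [0 <= 2 * y - x <= 1]. *)
have : 0 <= 4 * l / x - 2 * (l / y) <= 4 * (1 / x ^+ 2).
  have -> : 4 * l / x - 2 * (l / y) = 2 * l * (2 * y - x) / (x * y).
    by field; rewrite !gt_eqF.
  rewrite divr_ge0 /=; [|nra|nra].
  rewrite ler_pdivrMr ?mulr_gt0 // (_ : _ * (x * y) = 4 * y / x); last first.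
    by field; rewrite gt_eqF.
  rewrite ler_pdivlMr //.
  have : l * (2 * y - x) <= 1 by nra.
  nra.
by rewrite ler_norml; lra.
Qed.

(** * The bound for every n and the conclusion *)

Lemma disc_le_pow2 (R : realType) (n : nat) : (0 < n)%N ->
  disc R n <= 2 `^ (1 - 1 / (uphalf n)%:R).
Proof.
move=> n0; set m := uphalf n; have m0 : (0 < m)%N by rewrite uphalf_gt0.
set q : R := 2 `^ (m%:R^-1).
have qm : q ^+ m = 2.
  by rewrite -powR_mulrn ?powR_ge0 // -powRrM mulVf ?pnatr_eq0 -?lt0n // powRr1.
have q1 : 1 <= q by rewrite -(powRr0 2) ler_powR ?invr_ge0 // ler1n.
have q0 : 0 < q := lt_le_trans ltr01 q1.
have -> : 2 `^ (1 - 1 / m%:R) = 2 / q.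
  by rewrite powRB ?pnatr_eq0 ?implybT // powRr1 // div1r.
have [M [M1 Msplit Mratio]] := exists_lengths _ _ q1 qm m0.
(* As [n <= 2 * m], the lists up to time [n] are available for either parity of [n]. *)
have [t tn|S [nS lS]] := exists_strategy M n M1; first by apply: Msplit; lia.
apply: le_trans (disc_le _ _ _ nS) _.
apply: bigmax_le_seq => [|t]; first by rewrite divr_ge0 ?ltW.
rewrite mem_index_iota => tn _; apply: disc_partition_le.
  by rewrite divr_ge0 ?ltW.
move=> I J IP JP.
have memM K : K \in S t -> itv_len K \in M t.
  by move=> KP; rewrite -(perm_mem (lS t tn)) map_f.
have [|J0 IJ] := Mratio t _ _ _ (memM _ IP) (memM _ JP); first by lia.
by rewrite J0 mulrAC ler_pdivlMr // [_ * q]mulrC.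
Qed.

Theorem theorem1p2 (R : realType) :
  (forall n : nat, (0 < n)%N ->
     disc R n <= 2 `^ (1 - 1 / (Num.ceil (n%:R / 2 : R))%:~R)) /\
  ((fun n : nat => 2 `^ (1 - 1 / (Num.ceil (n%:R / 2 : R))%:~R) : R)
   = (fun n : nat => 2 - 4 * ln 2 / n%:R : R) +O_\oo
     (fun n : nat => 1 / n%:R ^+ 2 : R)).
Proof.
split=> [n n0|]; first by rewrite ceil_half; apply: disc_le_pow2.
apply/eqaddOP; near=> k; near=> n.
have n0 : (0 < n)%N by near: n; exists 1%N.
rewrite !fctE ceil_half [X in _ <= k * X]ger0_norm ?divr_ge0 ?exprn_ge0 //.
(* Any [k >= 12] serves as the constant. *)
apply: le_trans (pow2_asymptotics R _ n0) _.
by rewrite ler_wpM2r ?divr_ge0 ?exprn_ge0 //; near: k; apply: nbhs_pinfty_ge.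
Unshelve. all: by end_near. Qed.
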